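(* Let $G$ be a countably infinite discrete abelian group and let $(g_k)_{k\geqslant 0}$ be a sequence of elements of $G$ which generates the group $G$. For $\chi,\varphi\in\widehat{G}$ put $d_{(g_k)}(\chi,\varphi)=\sup_{k\geqslant 0}|\chi(g_k)-\varphi(g_k)|$, which is a distance on $\widehat{G}$. Then the following assertions are equivalent: (1) $(g_k)_{k\geqslant 0}$ is a $G$-Jamison sequence; (2) for every uncountable subset $K$ of $\widehat{G}$, the metric space $(K,d_{(g_k)})$ is non-separable; (3) for every uncountable subset $K$ of $\widehat{G}$, there exists $\varepsilon>0$ such that $K$ contains an uncountable $\varepsilon$-separated family for the distance $d_{(g_k)}$; (4) there exists $\varepsilon>0$ such that every uncountable subset $K$ of $\widehat{G}$ contains an uncountable $\varepsilon$-separated family for the distance $d_{(g_k)}$; (5) there exists $\varepsilon>0$ such that any two distinct characters of $G$ are $\varepsilon$-separated for the distance $d_{(g_k)}$: $$\forall (\chi,\varphi)\in\widehat{G}\times\widehat{G},\qquad \chi\neq\varphi\ \Longrightarrow\ \sup_{k\geqslant 0}|\chi(g_k)-\varphi(g_k)|\geqslant\varepsilon .$$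
   Context: For a complex Banach space $X$, $\mathcal{GL}(X)$ denotes the group of invertible bounded linear operators on $X$. A representation of a topological abelian group $G$ is a couple $(X,\rho)$ where $X$ is a separable infinite-dimensional complex Banach space and $\rho:G\to\mathcal{GL}(X)$ is a continuous group homomorphism (continuity is automatic when $G$ is discrete). $\mathbb{T}$ is the unit circle of the complex plane. $\widehat{G}$ is the group of all continuous homomorphisms (characters) $\chi:G\to\mathbb{T}$; for $G$ discrete, these are all homomorphisms $G\to\mathbb{T}$. A character $\chi\in\widehat{G}$ is a unimodular eigenvalue of a representation $(X,\rho)$ of $G$ if there is $e_\chi\in X\setminus\{0\}$ such that $\rho(g)e_\chi=\chi(g)e_\chi$ for all $g\in G$. The set of unimodular eigenvalues is denoted by $\sigma_p(\rho)\cap\widehat{G}$. The representation is partially bounded with respect to a sequence $(g_k)_{k\geqslant 0}$ of elements of $G$ if $\sup_{k\geqslant 0}\|\rho(g_k)\|<+\infty$. A sequence $(g_k)_{k\geqslant 0}$ of elements of $G$ is a $G$-Jamison sequence if for every representation $(X,\rho)$ of $G$ which is partially bounded with respect to $(g_k)_{k\geqslant 0}$, the set $\sigma_p(\rho)\cap\widehat{G}$ is at most countable. A family of elements of a metric space $(M,d)$ is $\varepsilon$-separated if $d(x,y)\geqslant\varepsilon$ for any two distinct members $x,y$ of the family. *)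

(* Defs.v *)
From HB Require Import structures.
From mathcomp Require Export all_boot all_order all_algebra.
From mathcomp Require Export complex.
From mathcomp Require Export all_classical all_reals all_analysis.
Export numFieldNormedType.Exports.
Import Order.TTheory GRing.Theory Num.Theory.

Set Implicit Arguments.
Unset Strict Implicit.
Unset Printing Implicit Defensive.

Local Open Scope classical_set_scope.
Local Open Scope ring_scope.
Local Open Scope complex_scope.

(* The norm of a normed module over [R[i]] is [R[i]]-valued (and real), hence
   the projection [complex.Re] when a value in [R] is needed. *)
Definition rnorm (R : realType) (V : normedModType R[i]) (x : V) : R :=
  complex.Re `|x|.

Section Representations.
Variables (R : realType) (X : completeNormedModType R[i]).

Definition separable_space : Prop :=
  exists D : set X, countable D /\ dense D.

Definition infinite_dimensional : Prop :=
  forall (n : nat) (v : 'I_n -> X),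
    exists x : X, forall a : 'I_n -> R[i], x <> \sum_(i < n) a i *: v i.

Definition opnorm (T : X -> X) : \bar R :=
  ereal_sup [set (rnorm (T x))%:E | x in [set x | rnorm x <= 1]].

Definition bounded_linear (T : X -> X) : Prop :=
  linear T /\ (opnorm T < +oo)%E.

Definition GL : set (X -> X) :=
  [set T | bounded_linear T /\
     exists S : X -> X, [/\ bounded_linear S, cancel T S & cancel S T]].

Variable G : zmodType.

(* [G] is a discrete group, so no continuity is required of [rho] (nor of the
   characters below).  The law of [G] is written additively. *)
Definition representation (rho : G -> X -> X) : Prop :=
  [/\ separable_space, infinite_dimensional,
      forall a, GL (rho a)
    & forall a b, rho (a + b) = rho a \o rho b].

Definition partially_bounded (g : nat -> G) (rho : G -> X -> X) : Prop :=
  (ereal_sup (range (fun k => opnorm (rho (g k)))) < +oo)%E.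

End Representations.

Section Characters.
Variables (R : realType) (G : zmodType).

Definition dual_group : set (G -> R[i]) :=
  [set chi | (forall a, `|chi a| = 1) /\
             (forall a b, chi (a + b) = chi a * chi b)].

Definition unimodular_eigenvalues (X : completeNormedModType R[i])
    (rho : G -> X -> X) : set (G -> R[i]) :=
  [set chi | dual_group chi /\
     exists2 e : X, e != 0 & forall a, rho a e = chi a *: e].

Definition jamison_sequence (g : nat -> G) : Prop :=
  forall (X : completeNormedModType R[i]) (rho : G -> X -> X),
    representation rho -> partially_bounded g rho ->
    countable (unimodular_eigenvalues rho).

Definition jdist (g : nat -> G) (chi phi : G -> R[i]) : R :=
  sup (range (fun k => complex.Re `|chi (g k) - phi (g k)|)).

End Characters.

Definition generates (G : zmodType) (g : nat -> G) : Prop :=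
  smallest [set H : set G | zmod_closed [in H]] (range g) = [set: G].

Section Distances.
Variables (R : realType) (T : Type) (d : T -> T -> R).

Definition is_distance (A : set T) : Prop :=
  [/\ forall x y, A x -> A y -> 0 <= d x y,
      forall x y, A x -> A y -> (d x y = 0 <-> x = y),
      forall x y, A x -> A y -> d x y = d y x
    & forall x y z, A x -> A y -> A z -> d x z <= d x y + d y z].

Definition metric_separable (K : set T) : Prop :=
  exists D : set T, [/\ D `<=` K, countable D
    & forall x, K x -> forall e : R, 0 < e -> exists2 y, D y & d x y < e].

Definition separated (e : R) (A : set T) : Prop :=
  forall x y, A x -> A y -> x <> y -> e <= d x y.

End Distances.

Section JdistDistance.
Variables (R : realType) (G : zmodType) (g : nat -> G).
Implicit Types chi phi psi : G -> R[i].

Let ReK (z : R[i]) : (complex.Re `|z|)%:C = `|z|.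
Proof. by rewrite RRe_real // normr_real. Qed.

Let Re_norm_le (z : R[i]) (c : R) :
  (complex.Re `|z| <= c) = (`|z| <= c%:C).
Proof. by rewrite -[in RHS](ReK z) lecR. Qed.

Let dist_ubound chi phi : dual_group chi -> dual_group phi ->
  has_sup (range (fun k => complex.Re `|chi (g k) - phi (g k)|)).
Proof.
move=> [c1 _] [p1 _]; split; first by exists (complex.Re `|chi (g 0) - phi (g 0)|); exists 0%N.
exists 2 => _ [k _ <-]; rewrite Re_norm_le; apply: le_trans (ler_normB _ _) _.
by rewrite c1 p1 rmorphD.
Qed.

Lemma jdist_ub chi phi k : dual_group chi -> dual_group phi ->
  complex.Re `|chi (g k) - phi (g k)| <= jdist g chi phi.
Proof.
by move=> hc hp; apply: sup_upper_bound; [exact: dist_ubound | exists k].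
Qed.

Lemma jdist_distance : generates g -> is_distance (jdist g) (@dual_group R G).
Proof.
move=> gG.
have d0 chi phi : dual_group chi -> dual_group phi -> 0 <= jdist g chi phi.
  move=> hc hp; apply: le_trans (jdist_ub 0 hc hp).
  by rewrite -lecR ReK; exact: normr_ge0.
split => //.
- move=> chi phi hc hp; split; last first.
    move=> <-; apply/eqP; rewrite eq_le d0 // andbT; apply: ge_sup.
      by have [] := dist_ubound hc hc.
    by move=> _ [k _ <-]; rewrite subrr normr0.
  move=> e0; apply/funext => a.
  have [[c1 cD] [p1 pD]] := (hc, hp).
  suff : [set: G] `<=` [set a | chi a = phi a] by apply.
  have nz (f : G -> R[i]) : (forall a, `|f a| = 1) -> forall a, f a != 0.
    by move=> f1 b; rewrite -normr_gt0 f1.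
  have f0 (f : G -> R[i]) : (forall a, `|f a| = 1) ->
      (forall a b, f (a + b) = f a * f b) -> f 0 = 1.
    move=> f1 fD; apply: (mulfI (nz _ f1 0)).
    by rewrite -fD addr0 mulr1.
  rewrite -gG; apply: smallest_sub.
    split=> [|u v]; first by apply: mem_set; rewrite /= !f0.
    move=> /set_mem /= cu /set_mem /= cv; apply: mem_set => /=.
    apply: (mulIf (nz _ c1 v)).
    by rewrite -cD subrK cv -pD subrK.
  move=> _ [k _ <-] /=; apply/eqP; rewrite -subr_eq0 -normr_le0.
  by rewrite -[leRHS]/(0%:C) -Re_norm_le -e0; exact: jdist_ub.
- by move=> chi phi _ _; congr sup; apply: eq_imagel => k _; rewrite distrC.
- move=> x y z hx hy hz; apply: ge_sup.
    by have [] := dist_ubound hx hz.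
  move=> _ [k _ <-]; apply: le_trans (lerD (jdist_ub k hx hy) (jdist_ub k hy hz)).
  by rewrite Re_norm_le rmorphD /= !ReK; exact: ler_distD.
Qed.

End JdistDistance.

(* Main.v *)
From HB Require Import structures.
From mathcomp Require Import ring lra.
Require Import Defs.
Import Order.TTheory GRing.Theory Num.Theory.

Set Implicit Arguments.
Unset Strict Implicit.
Unset Printing Implicit Defensive.

Local Open Scope classical_set_scope.
Local Open Scope ring_scope.
Local Open Scope complex_scope.

(** Write [d] for [jdist g].  The implications go round the cycle (1), (2), ...,
    (5), and rest on three facts.

    A separable uncountable [K] defeats the Jamison property
    ([jamison_not_separable]).  Let [len a] be the word length of [a] with
    respect to the elements [g k] and their opposites.  Take the functions [F]
    on [G] with norm [sup_a |F a| / 2 ^ len a], let [X] be the closed span of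
    the characters in [K], and let [G] act on [X] by translations.  A
    translation by [g k] changes [len] by at most one, hence has norm at most 2.
    The characters in [K] are eigenvectors, so each of them is an eigenvalue.
    Two characters satisfy [|chi a - phi a| <= len a * d chi phi], whence
    [||chi - phi|| <= d chi phi]; therefore [X] inherits separability from [K].
    It is infinite-dimensional since distinct characters are linearly
    independent ([char_free]).

    If the dual group is not uniformly discrete, it contains a separable
    uncountable set ([separable_uncountable_ex]).  By translation there are
    characters different from 1 and arbitrarily close to 1; the monoid that a
    sequence of them generates is countable and has no isolated point, and the
    dual group is complete for [d], so the closure of this monoid is a separable
    perfect complete space, which a nested-ball argument shows to be uncountable
    ([jclosure_uncountable]).  This turns (2) into (5).  A separable set has
    no uncountable separated subset ([separated_countable]), so (3) and (4) both
    imply (2), and (5) gives back (3) and (4) with the whole of [K] as the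
    separated family.

    If the dual group is [e]-separated, [g] is a Jamison sequence
    ([uniformly_separated_jamison]).  When [||rho (g k)|| <= M] for all [k],
    normalised eigenvectors [u], [v] for [chi], [phi] satisfy
    [d chi phi <= (M + 1) * ||u - v||].  Eigenvectors for distinct characters
    are thus uniformly apart, and a separable space holds countably many of
    them. *)

(** * Real-valued norms and completeness of the complex numbers *)

(** The modulus of a complex number is the instance of [rnorm] at the
    one-dimensional space, so that both share one set of lemmas. *)
Local Notation modulus := (@rnorm _ (_[i]^o)).

Section RealNorm.
Context {R : realType} {V : normedModType R[i]}.
Implicit Types (x y : V) (a : R[i]).

Lemma rnormE x : `|x| = (rnorm x)%:C.
Proof. by rewrite /rnorm RRe_real // normr_real. Qed.

Lemma rnorm_ge0 x : 0 <= rnorm x.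
Proof. by rewrite -lecR -rnormE; exact: normr_ge0. Qed.

Lemma rnorm_le x (c : R) : (rnorm x <= c) = (`|x| <= c%:C).
Proof. by rewrite rnormE lecR. Qed.

Lemma rnorm_lt x (c : R) : (rnorm x < c) = (`|x| < c%:C).
Proof. by rewrite rnormE ltcR. Qed.

Lemma rnormD x y : rnorm (x + y) <= rnorm x + rnorm y.
Proof. by rewrite rnorm_le rmorphD /= -!rnormE; exact: ler_normD. Qed.

Lemma rnormN x : rnorm (- x) = rnorm x.
Proof. by rewrite /rnorm normrN. Qed.

Lemma rnorm_distC x y : rnorm (x - y) = rnorm (y - x).
Proof. by rewrite -rnormN opprB. Qed.

Lemma rnorm_distD y x z : rnorm (x - z) <= rnorm (x - y) + rnorm (y - z).
Proof. by rewrite -[x - z](subrKA y); exact: rnormD. Qed.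

Lemma rnorm0 : rnorm (0 : V) = 0.
Proof. by rewrite /rnorm normr0. Qed.

Lemma rnorm_eq0 x : (rnorm x == 0) = (x == 0).
Proof. by rewrite -[in RHS]normr_eq0 rnormE -[in LHS](inj_eq (@complexI R)). Qed.

Lemma rnorm_gt0 x : (0 < rnorm x) = (x != 0).
Proof. by rewrite lt_neqAle rnorm_ge0 andbT eq_sym rnorm_eq0. Qed.

Lemma rnormZ a x : rnorm (a *: x) = modulus a * rnorm x.
Proof.
by apply: (@complexI R); rewrite rmorphM /= -!rnormE normrZ.
Qed.

End RealNorm.

Section ComplexModulus.
Context {R : realType}.
Implicit Types a b : R[i].

Lemma modulusM a b : modulus (a * b) = modulus a * modulus b.
Proof. by apply: (@complexI R); rewrite rmorphM /= -!rnormE normrM. Qed.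

Lemma modulusR (x : R) : modulus x%:C = `|x|.
Proof. by rewrite /rnorm normc_def /= expr0n addr0 sqrtr_sqr. Qed.

(** The radii of balls in a complex normed space are complex numbers; this
    brings them back to the reals. *)
Lemma gt0_complexP a : 0 < a -> exists2 r : R, 0 < r & a = r%:C.
Proof.
move=> a0; have ar : (complex.Re a)%:C = a by rewrite RRe_real// ger0_real// ltW.
by exists (complex.Re a); rewrite -?ltcR ar.
Qed.

Lemma Re_le_modulus a : `|complex.Re a| <= modulus a.
Proof.
case: a => x y; rewrite /rnorm normc_def /=.
by rewrite -sqrtr_sqr ler_wsqrtr// lerDl sqr_ge0.
Qed.

Lemma Im_le_modulus a : `|complex.Im a| <= modulus a.
Proof.
case: a => x y; rewrite /rnorm normc_def /=.
by rewrite -sqrtr_sqr ler_wsqrtr// lerDr sqr_ge0.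
Qed.

Lemma modulus_le_ReIm a : modulus a <= `|complex.Re a| + `|complex.Im a|.
Proof.
rewrite [a in leLHS]complexE; apply: le_trans (rnormD _ _) _.
by rewrite modulusM !modulusR {1}/rnorm normc_def/= expr0n expr1n add0r sqrtr1 mul1r.
Qed.

(** The real and imaginary parts are contractions, so they send a Cauchy filter
    to Cauchy filters of the complete real line. *)
Lemma complex_cauchy_cvg (F : set_system R[i]^o) :
  ProperFilter F -> cauchy F -> cvg F.
Proof.
move=> FF Fc.
have pos (e : R) : 0 < e -> (0 : R[i]) < e%:C by rewrite ltcR.
have cauchy_part (p : R[i] -> R) : (forall a b, p (a - b) = p a - p b) ->
    (forall a, `|p a| <= modulus a) -> cvg (p @ F).
  move=> pB p_le; apply: cauchy_cvg; apply/cauchy_ballP => e e0.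
  have /cauchy_ballP/(_ _ (pos _ e0)) := Fc.
  case=> -[A B] /= [FA FB] AB; exists (p @` A, p @` B).
    by split; [apply: filterS FA | apply: filterS FB] => z Az; exists z.
  move=> [_ _] /= [[a Aa <-] [b Bb <-]].
  have := AB (a, b) (conj Aa Bb).
  rewrite -!ball_normE/= -pB -rnorm_lt; exact: le_lt_trans (p_le _).
have ReB (a b : R[i]) : complex.Re (a - b) = complex.Re a - complex.Re b.
  by case: a b => [? ?] [? ?].
have ImB (a b : R[i]) : complex.Im (a - b) = complex.Im a - complex.Im b.
  by case: a b => [? ?] [? ?].
have /cvg_ex[x Fx] := cauchy_part _ ReB Re_le_modulus.
have /cvg_ex[y Fy] := cauchy_part _ ImB Im_le_modulus.
apply/cvg_ex; exists (x +i* y); apply/cvgrPdist_lt => _ /gt0_complexP[e e0 ->].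
have e2 : 0 < e / 2 by rewrite divr_gt0.
near=> z; rewrite -rnorm_lt.
apply: le_lt_trans (modulus_le_ReIm _) _.
rewrite ReB ImB [ltRHS]splitr; apply: ltrD; near: z.
  by move/cvgrPdist_lt : Fx; apply.
by move/cvgrPdist_lt : Fy; apply.
Unshelve. all: by end_near. Qed.

End ComplexModulus.

(** * Selections from countable sets *)

(** Points that are told apart by nearby points of a countable set are countably
    many: this is how separability bounds the number of separated points. *)
Lemma countable_of_selection (T U : Type) (A : set T) (D : set U)
    (near : T -> U -> Prop) : countable D ->
    (forall x, A x -> exists2 y, D y & near x y) ->
    (forall x x' y, A x -> A x' -> near x y -> near x' y -> x = x') ->
  countable A.
Proof.
move=> /countable_injP[code codeI] Anear nearI.
have codeP x : exists n, A x -> exists y, [/\ D y, near x y & code y = n].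
  have [Ax|nAx] := pselect (A x); last by exists 0%N.
  by have [y Dy xy] := Anear x Ax; exists (code y) => _; exists y.
have [f fP] := choice codeP.
apply/countable_injP; exists f => x x' /[!inE] Ax Ax' ff'.
have [y [Dy xy fy]] := fP x Ax; have [y' [Dy' xy' fy']] := fP x' Ax'.
have yy' : y = y' by apply: codeI; rewrite ?inE// fy fy'.
by apply: nearI xy _; rewrite // yy'.
Qed.

(** * Word length with respect to the generators *)

Section WordLength.
Context {G : zmodType} {g : nat -> G}.

(** A letter [(b, k)] stands for [g k], or for its opposite when [b] holds. *)
Definition word_value (s : seq (bool * nat)) : G :=
  \sum_(i <- s) (if i.1 then - g i.2 else g i.2).

Lemma word_value_ex : generates g -> forall a, exists s, word_value s = a.
Proof.
move=> gG a; suff : [set: G] `<=` range word_value.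
  by move=> /(_ a I)[s _ <-]; exists s.
rewrite -gG; apply: smallest_sub => [|_ [k _ <-]]; last first.
  by exists [:: (false, k)] => //; rewrite /word_value big_seq1.
split=> [|u v].
  by apply/mem_set; exists [::] => //; rewrite /word_value big_nil.
rewrite !inE => -[s _ <-] [t _ <-].
exists (s ++ [seq (~~ i.1, i.2) | i <- t]) => //.
rewrite /word_value big_cat/= big_map/= -sumrN; congr (_ + _).
by apply: eq_bigr => -[[] k] _ /=; rewrite ?opprK.
Qed.

Hypothesis g_generates : generates g.

Let length_spec a : exists n,
  `[< exists s : seq (bool * nat), size s = n /\ word_value s = a >].
Proof.
by have [s sa] := word_value_ex g_generates a; exists (size s); apply/asboolP; exists s.
Qed.

Definition word_length a : nat := ex_minn (length_spec a).

Lemma word_lengthP a : exists2 s, size s = word_length a & word_value s = a.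
Proof.
by rewrite /word_length; case: ex_minnP => n /asboolP[s [? ?]] _; exists s.
Qed.

Lemma word_length_le s : (word_length (word_value s) <= size s)%N.
Proof.
by rewrite /word_length; case: ex_minnP => n _; apply; apply/asboolP; exists s.
Qed.

Lemma word_lengthD a b : (word_length (a + b) <= word_length a + word_length b)%N.
Proof.
have [[s <- sa] [t <- tb]] := (word_lengthP a, word_lengthP b).
rewrite -size_cat -sa -tb /word_value -big_cat; exact: word_length_le.
Qed.

Lemma word_length_gen k : (word_length (g k) <= 1)%N.
Proof.
have := word_length_le [:: (false, k)]; by rewrite /word_value big_seq1.
Qed.

End WordLength.
Arguments word_length {G g} g_generates a.

(** * Characters and the distance of the sequence *)

Section DualGroup.
Context {R : realType} {G : zmodType}.
Implicit Types (chi phi psi : G -> R[i]) (a b : G).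

Lemma modulus_char chi a : dual_group chi -> modulus (chi a) = 1.
Proof. by move=> [chi1 _]; rewrite /rnorm chi1. Qed.

Lemma charD chi a b : dual_group chi -> chi (a + b) = chi a * chi b.
Proof. by move=> []. Qed.

Lemma char_neq0 chi a : dual_group chi -> chi a != 0.
Proof. by move=> [chi1 _]; rewrite -normr_gt0 chi1. Qed.

Lemma char0 chi : dual_group chi -> chi 0 = 1.
Proof.
by move=> chiG; apply: (mulfI (char_neq0 0 chiG)); rewrite -charD// addr0 mulr1.
Qed.

Lemma charNK chi a : dual_group chi -> chi a * chi (- a) = 1.
Proof. by move=> chiG; rewrite -charD// subrr char0. Qed.

Lemma char_one : dual_group (fun _ : G => 1 : R[i]).
Proof. by split=> [a|a b]; rewrite ?normr1 ?mulr1. Qed.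

Lemma char_mul chi phi : dual_group chi -> dual_group phi ->
  dual_group (fun a => chi a * phi a).
Proof.
move=> [chi1 chiD] [phi1 phiD]; split=> [a|a b].
  by rewrite normrM chi1 phi1 mulr1.
by rewrite chiD phiD mulrACA.
Qed.

Lemma char_div chi phi : dual_group chi -> dual_group phi ->
  dual_group (fun a => chi a / phi a).
Proof.
move=> [chi1 chiD] [phi1 phiD]; split=> [a|a b].
  by rewrite normf_div chi1 phi1 divr1.
by rewrite chiD phiD invfM mulrACA.
Qed.

Context {g : nat -> G}.

Lemma jdist_ge chi phi k : dual_group chi -> dual_group phi ->
  modulus (chi (g k) - phi (g k)) <= jdist g chi phi.
Proof. exact: jdist_ub. Qed.

Lemma jdist_le chi phi (c : R) :
  (forall k, modulus (chi (g k) - phi (g k)) <= c) -> jdist g chi phi <= c.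
Proof.
move=> le_c; apply: ge_sup => [|_ [k _ <-]]; last exact: le_c.
by exists (modulus (chi (g 0) - phi (g 0))); exists 0%N.
Qed.

Lemma jdist_mulr chi phi psi : dual_group psi ->
  jdist g (fun a => chi a * psi a) (fun a => phi a * psi a) = jdist g chi phi.
Proof.
move=> psiG; congr sup; apply: eq_imagel => k _.
by rewrite -mulrBl normrM (proj1 psiG) mulr1.
Qed.

Hypothesis g_generates : generates g.

(** Characters are multiplicative and unimodular, so each letter of a word costs
    at most [jdist g chi phi]. *)
Lemma char_dist_word_length chi phi a : dual_group chi -> dual_group phi ->
  modulus (chi a - phi a) <= (word_length g_generates a)%:R * jdist g chi phi.
Proof.
move=> chiG phiG; have [s <- <-] := word_lengthP g_generates a.
have addE x y : modulus (chi (x + y) - phi (x + y)) <=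
    modulus (chi x - phi x) + modulus (chi y - phi y).
  rewrite !charD//.
  apply: le_trans (@rnorm_distD R R[i]^o (phi x * chi y) _ _) _.
  by rewrite -mulrBl -mulrBr !modulusM !modulus_char// mulr1 mul1r.
have letter k : modulus (chi (- g k) - phi (- g k)) <= jdist g chi phi.
  (* The value at [- g k] is the inverse of the value at [g k]. *)
  suff -> : chi (- g k) - phi (- g k) =
      chi (- g k) * phi (- g k) * (phi (g k) - chi (g k)).
    by rewrite !modulusM !modulus_char// !mul1r rnorm_distC; exact: jdist_ge.
  rewrite mulrBr -mulrA [_ * phi (g k)]mulrC charNK// mulr1.
  by rewrite mulrAC [_ * chi (g k)]mulrC charNK// mul1r.
elim: s => [|[[] k] s IH]; rewrite /word_value ?big_nil ?big_cons/=.
- by rewrite !char0// subrr rnorm0 mul0r.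
- by apply: le_trans (addE _ _) _; rewrite -natr1 mulrDl mul1r addrC lerD.
- apply: le_trans (addE _ _) _; rewrite -natr1 mulrDl mul1r addrC lerD//.
  exact: jdist_ge.
Qed.

End DualGroup.

(** * Weighted closed spans of characters *)

Section WeightedSpan.
Context {R : realType} {G : zmodType}.
Variables (w : G -> R) (K : set (G -> R[i]^o)).

Definition lincomb (s : seq (R[i] * (G -> R[i]^o))) : G -> R[i]^o :=
  \sum_(t <- s) t.1 *: t.2.

Definition spanned_by (s : seq (R[i] * (G -> R[i]^o))) : Prop :=
  forall t, t \in s -> K t.2.

(** The closure of the span of [K] for the norm with weight [w].  Closeness to a
    combination of unimodular functions makes [F / w] bounded, so the norm below
    is finite. *)
Definition approx_span : {pred G -> R[i]^o} := fun F =>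
  `[< forall e : R, 0 < e ->
      exists2 s, spanned_by s & forall a, modulus (F a - lincomb s a) <= e * w a >].

Lemma approx_spanP F : reflect (forall e : R, 0 < e ->
    exists2 s, spanned_by s & forall a, modulus (F a - lincomb s a) <= e * w a)
  (F \in approx_span).
Proof. exact: asboolP. Qed.

Lemma lincombD s1 s2 : lincomb (s1 ++ s2) = lincomb s1 + lincomb s2.
Proof. exact: big_cat. Qed.

Lemma lincombZ c s : lincomb [seq (c * t.1, t.2) | t <- s] = c *: lincomb s.
Proof.
by rewrite /lincomb big_map scaler_sumr; apply: eq_bigr => t _; rewrite scalerA.
Qed.

(** The proofs [w_ge1] and [K_char] are arguments of the type because the vector
    space and norm structures, which depend on them, are found from the type
    alone. *)
Record span_space (w_ge1 : forall a, 1 <= w a) (K_char : K `<=` @dual_group R G) :=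
  SpanSpace { span_fun :> G -> R[i]^o; _ : span_fun \in approx_span }.

Hypotheses (w_ge1 : forall a, 1 <= w a) (K_char : K `<=` @dual_group R G).

Let w_gt0 a : 0 < w a. Proof. exact: lt_le_trans (w_ge1 a). Qed.

Lemma approx_span_submod : submod_closed approx_span.
Proof.
split.
  apply/approx_spanP => e e0; exists [::] => // a.
  by rewrite /lincomb big_nil subrr rnorm0 mulr_ge0// ltW.
move=> c F H /approx_spanP FK /approx_spanP HK; apply/approx_spanP => e e0.
have c1 : 0 < modulus c + 1 by rewrite ltr_wpDl// rnorm_ge0.
have e2 : 0 < e / 2 by apply: divr_gt0; rewrite ?ltr0n.
have [s sK Fs] := FK (e / 2 / (modulus c + 1)) (divr_gt0 e2 c1).
have [t tK Ht] := HK (e / 2) e2.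
exists ([seq (c * u.1, u.2) | u <- s] ++ t) => [u|a].
  by rewrite mem_cat => /orP[/mapP[v vs ->]|ut]; [exact: sK v vs | exact: tK u ut].
rewrite lincombD lincombZ [X in modulus X](_ : _ =
    c * (F a - lincomb s a) + (H a - lincomb t a)); last first.
  by rewrite !fctE/= mulrBr opprD addrACA.
apply: le_trans (rnormD _ _) _; rewrite [e in leRHS]splitr mulrDl lerD// modulusM.
apply: le_trans (ler_wpM2l (rnorm_ge0 _) (Fs a)) _.
rewrite mulrA ler_wpM2r ?(ltW (w_gt0 _))// mulrCA ger_pMr ?divr_gt0//.
by rewrite ler_pdivrMr// mul1r lerDl.
Qed.

HB.instance Definition _ :=
  GRing.isSubmodClosed.Build R[i] (G -> R[i]^o) approx_span approx_span_submod.

Notation X := (span_space w_ge1 K_char).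

HB.instance Definition _ := [isSub for @span_fun w_ge1 K_char].
HB.instance Definition _ := [Choice of X by <:].
HB.instance Definition _ := [SubChoice_isSubLmodule of X by <:].

(** A combination of characters is bounded by the sum of the moduli of its
    coefficients; the remaining distance to it costs one more. *)
Lemma span_space_bounded (F : X) :
  exists2 C : R, 0 <= C & forall a, modulus (F a) <= C * w a.
Proof.
case: F => F /= /approx_spanP/(_ 1 ltr01)[s sK Fs].
exists (1 + \sum_(t <- s) modulus t.1) => [|a].
  by rewrite addr_ge0// sumr_ge0// => t _; exact: rnorm_ge0.
rewrite mulrDl -[F a](subrK (lincomb s a)).
apply: le_trans (rnormD _ _) _; apply: lerD; first exact: Fs.
apply: (@le_trans _ _ (\sum_(t <- s) modulus t.1)); last first.
  by rewrite ler_peMr// sumr_ge0// => t _; exact: rnorm_ge0.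
rewrite /lincomb; elim: s sK {Fs} => [|t s IH] sK.
  by rewrite !big_nil rnorm0.
rewrite !big_cons [X in modulus X <= _](_ : _ = t.1 * t.2 a +
  (\sum_(u <- s) u.1 *: u.2) a)//.
apply: le_trans (rnormD _ _) _; apply: lerD; last first.
  by apply: IH => u us; apply: sK; rewrite in_cons us orbT.
have /K_char tG : K t.2 by apply: sK; rewrite mem_head.
by rewrite modulusM (modulus_char a tG) mulr1.
Qed.

Definition span_rnorm (F : X) : R := sup (range (fun a => modulus (F a) / w a)).

Let has_sup_ratio (F : X) : has_sup (range (fun a => modulus (F a) / w a)).
Proof.
split; first by exists (modulus (F 0) / w 0); exists 0.
have [C _ FC] := span_space_bounded F; exists C => _ [a _ <-].
by rewrite ler_pdivrMr.
Qed.

Lemma span_rnorm_ub (F : X) a : modulus (F a) <= span_rnorm F * w a.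
Proof.
by rewrite -ler_pdivrMr//; apply: sup_upper_bound; [exact: has_sup_ratio | exists a].
Qed.

Lemma span_rnorm_le (F : X) (c : R) :
  (forall a, modulus (F a) <= c * w a) -> span_rnorm F <= c.
Proof.
move=> Fc; apply: ge_sup => [|_ [a _ <-]]; first by case: (has_sup_ratio F).
by rewrite ler_pdivrMr.
Qed.

Lemma span_rnorm_ge0 (F : X) : 0 <= span_rnorm F.
Proof.
by rewrite -(pmulr_lge0 _ (w_gt0 0)); apply: le_trans (span_rnorm_ub F 0); exact: rnorm_ge0.
Qed.

Let norm (F : X) : R[i] := (span_rnorm F)%:C.

Let norm_triangle (F H : X) : norm (F + H) <= norm F + norm H.
Proof.
rewrite -rmorphD lecR; apply: span_rnorm_le => a.
by apply: le_trans (rnormD _ _) _; rewrite mulrDl lerD ?span_rnorm_ub.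
Qed.

Let norm_eq0 (F : X) : norm F = 0 -> F = 0.
Proof.
move=> /complexI F0; apply/val_inj/funext => a /=.
apply/eqP; rewrite -(@rnorm_eq0 R R[i]^o) eq_le rnorm_ge0 andbT.
by apply: le_trans (span_rnorm_ub F a) _; rewrite F0 mul0r.
Qed.

Let normZ c (F : X) : norm (c *: F) = `|c| * norm F.
Proof.
have le_norm d (H : X) : span_rnorm (d *: H) <= modulus d * span_rnorm H.
  apply: span_rnorm_le => a; rewrite [X in modulus X](_ : _ = d * H a)// modulusM.
  by rewrite -mulrA ler_wpM2l ?rnorm_ge0 ?span_rnorm_ub.
have [->|c0] := eqVneq c 0.
  rewrite normr0 mul0r /norm; congr (_%:C); apply/eqP; rewrite eq_le span_rnorm_ge0.
  by rewrite andbT; apply: le_trans (le_norm _ _) _; rewrite rnorm0 mul0r.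
rewrite (rnormE (c : R[i]^o)) -rmorphM; congr (_%:C); apply/eqP; rewrite eq_le le_norm/=.
have m0 : 0 < modulus c by rewrite rnorm_gt0.
rewrite mulrC -ler_pdivlMr//; apply: le_trans (_ : _ <= modulus c^-1 * _) _.
  by rewrite -[in leLHS](scalerK c0 F); exact: le_norm.
rewrite mulrC; suff -> : modulus c^-1 = (modulus c)^-1 by [].
by rewrite /rnorm normfV [in LHS](rnormE (c : R[i]^o)) -fmorphV.
Qed.

HB.instance Definition _ :=
  Lmodule_isNormed.Build R[i] X norm_triangle normZ norm_eq0.

(** These two lemmas characterise the norm; later arguments never return to the
    supremum. *)
Lemma rnorm_span_ub (F : X) a : modulus (F a) <= rnorm F * w a.
Proof. exact: span_rnorm_ub. Qed.

Lemma rnorm_span_le (F : X) (c : R) :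
  (forall a, modulus (F a) <= c * w a) -> rnorm F <= c.
Proof. exact: span_rnorm_le. Qed.

Let ball_rnorm (F H : X) (e : R) : ball F e%:C H <-> rnorm (F - H) < e.
Proof. by rewrite -ball_normE /= -rnorm_lt. Qed.

Lemma span_space_cauchy_cvg (Phi : set_system X) :
  ProperFilter Phi -> cauchy Phi -> cvg Phi.
Proof.
move=> PF cauchyPhi.
have near_point (e : R) : 0 < e -> exists F : X, Phi (ball F e%:C).
  move=> e0; have /cauchyP := cauchyPhi; apply.
  by rewrite ltcR.
(* Evaluations are Lipschitz, so a pointwise limit [L] exists. *)
have cvg_at a : cvg ((fun F : X => F a : R[i]^o) @ Phi).
  apply: complex_cauchy_cvg; apply: cauchy_exP => _ /gt0_complexP[e e0 ->].
  have [F Fe] := near_point _ (divr_gt0 e0 (w_gt0 a)).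
  exists (F a); rewrite -[_ (ball _ _)]/(Phi [set H : X | ball (F a : R[i]^o) e%:C (H a)]).
  apply: filterS Fe => H /ball_rnorm FH /=.
  rewrite -ball_normE/= -rnorm_lt; apply: le_lt_trans (rnorm_span_ub (F - H) a) _.
  by rewrite -ltr_pdivlMr.
have [L LP] := choice (fun a => (cvg_ex _).1 (cvg_at a)).
have close_to_L (e : R) (F : X) : Phi (ball F e%:C) ->
    forall a, modulus (F a - L a) <= e * w a.
  move=> Fe a; apply/ler_addgt0Pr => d d0.
  have /cvgrPdist_lt/(_ d%:C) := LP a; rewrite ltcR => /(_ d0) Ld.
  have [H [/ball_rnorm FH /=]] := filter_ex (filterI Fe Ld).
  rewrite -rnorm_lt => LH.
  apply: le_trans (@rnorm_distD R R[i]^o (H a) _ _) _; apply: lerD; last first.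
    by rewrite rnorm_distC ltW.
  apply: le_trans (rnorm_span_ub (F - H) a) _.
  by rewrite ler_wpM2r// ltW.
(* [L] stays in the closed span: an element of the space close to [L] is itself
   close to a combination of [K]. *)
have LX : L \in approx_span.
  apply/approx_spanP => e e0.
  have e2 : 0 < e / 2 by rewrite divr_gt0.
  have [[F FX] Fe] := near_point _ e2.
  have /approx_spanP/(_ _ e2)[s sK Fs] := FX.
  exists s => // a; rewrite [e in leRHS]splitr mulrDl.
  apply: le_trans (@rnorm_distD R R[i]^o (F a) _ _) _; apply: lerD => //.
  by rewrite rnorm_distC; exact: (close_to_L _ _ Fe).
apply/cvg_ex; exists (SpanSpace w_ge1 K_char LX); apply/cvgrPdist_lt => _ /gt0_complexP[e e0 ->].
have e2 : 0 < e / 2 by rewrite divr_gt0.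
have [F Fe] := near_point _ e2; apply: filterS (Fe) => H /ball_rnorm FH /=.
rewrite -rnorm_lt [ltRHS]splitr; apply: le_lt_trans (rnorm_distD F _ _) _.
apply: ler_ltD => //; apply: rnorm_span_le => a; rewrite rnorm_distC.
exact: close_to_L.
Qed.

HB.instance Definition _ := Uniform_isComplete.Build X span_space_cauchy_cvg.

End WeightedSpan.

(** * Criteria for separability and infinite dimension *)

Lemma countable_range (T : countType) U (f : T -> U) : countable (range f).
Proof. exact: sub_countable (card_image_le _ _) (countableP _). Qed.

Section Separability.
Context {R : realType}.

Lemma rat_complex_dense (c : R[i]) (e : R) : 0 < e ->
  exists q : rat * rat, modulus (c - (ratr q.1 +i* ratr q.2)) < e.
Proof.
move=> e0; have e2 : 0 < e / 2 by rewrite divr_gt0.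
have near (x : R) : exists q : rat, `|x - ratr q| < e / 2.
  have [|q] := @rat_in_itvoo _ (x - e / 2) (x + e / 2).
    by rewrite ltrD2l gtrN.
  by rewrite in_itv/= -ltr_distlC; exists q.
case: c => x y; have [[p xp] [q yq]] := (near x, near y).
exists (p, q); apply: le_lt_trans (modulus_le_ReIm _) _.
by rewrite [ltRHS]splitr; exact: ltrD.
Qed.

(** Combinations with rational complex coefficients form a countable dense set. *)
Lemma separable_of_generators (X : completeNormedModType R[i]) (E : set X) :
    countable E ->
    (forall (x : X) (e : R), 0 < e -> exists2 s : seq (R[i] * X),
      (forall t, t \in s -> E t.2) & rnorm (x - \sum_(t <- s) t.1 *: t.2) < e) ->
  separable_space X.
Proof.
move=> /countable_injP[code codeI] approx.
(* [decode] enumerates [E], so that words over the countable type of pairs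
   (rational coefficient, index) encode the rational combinations. *)
have decodeP n : exists x, forall y, E y -> code y = n -> x = y.
  have [[y [Ey yn]]|noy] := pselect (exists y, E y /\ code y = n).
    by exists y => z Ez zn; apply: codeI; rewrite ?inE// yn zn.
  by exists 0 => y Ey yn; case: noy; exists y.
have [decode decodeE] := choice decodeP.
pose comb (s : seq ((rat * rat) * nat)) : X :=
  \sum_(t <- s) (ratr t.1.1 +i* ratr t.1.2) *: decode t.2.
exists (range comb); split; first exact: countable_range.
suff comb_approx (s : seq (R[i] * X)) : (forall t, t \in s -> E t.2) ->
    forall e : R, 0 < e ->
    exists q, rnorm (\sum_(t <- s) t.1 *: t.2 - comb q) < e.
  move=> O [x Ox] Oopen.
  have /nbhs_ballP[_ /gt0_complexP[d d0 ->] xO] : nbhs x O by apply: open_nbhs_nbhs.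
  have d2 : 0 < d / 2 by rewrite divr_gt0.
  have [s sE xs] := approx x _ d2.
  have [q sq] := comb_approx s sE _ d2.
  exists (comb q); split; last by exists q.
  apply: xO; rewrite -ball_normE /= -rnorm_lt.
  by apply: le_lt_trans (rnorm_distD (\sum_(t <- s) t.1 *: t.2) _ _) _; rewrite [ltRHS]splitr ltrD.
elim: s => [|[c v] s IH] sE e e0.
  by exists [::]; rewrite /comb !big_nil subrr rnorm0.
have e2 : 0 < e / 2 by rewrite divr_gt0.
have [|q sq] := IH _ _ e2.
  by move=> t ts; apply: sE; rewrite in_cons ts orbT.
have v1 : 0 < rnorm v + 1 by rewrite ltr_wpDl// rnorm_ge0.
have [p cp] := rat_complex_dense c (divr_gt0 e2 v1).
have Ev : E v by apply: (sE (c, v)); rewrite mem_head.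
exists ((p, code v) :: q); rewrite /comb !big_cons/= (decodeE _ v)//.
rewrite opprD addrACA -scalerBl; apply: le_lt_trans (rnormD _ _) _.
rewrite [ltRHS]splitr; apply: ler_ltD => //; rewrite rnormZ.
apply: le_trans (_ : e / 2 / (rnorm v + 1) * (rnorm v + 1) <= _); last first.
  by rewrite divfK// gt_eqF.
by apply: ler_pM; rewrite ?rnorm_ge0// ?ltW// ltrDl.
Qed.

End Separability.

Section LinearIndependence.
Context {R : realType}.

(** Otherwise [n.+1] independent vectors would have their coordinates in the rows
    of a matrix with [n] columns, and such a matrix has a left kernel. *)
Lemma infinite_dimensional_of_free (X : completeNormedModType R[i]) :
    (forall n, exists u : 'I_n -> X, forall c : 'I_n -> R[i],
       \sum_(i < n) c i *: u i = 0 -> forall i, c i = 0) ->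
  infinite_dimensional X.
Proof.
move=> free n v; apply: contrapT => /forallNP spanned.
have coordP (x : X) : exists a : 'I_n -> R[i], x = \sum_(i < n) a i *: v i.
  by have /existsNP[a /contrapT] := spanned x; exists a.
have [u uI] := free n.+1.
have [M MP] := choice (fun i => coordP (u i)).
pose A : 'M[R[i]]_(n.+1, n) := \matrix_(i, j) M i j.
have /rowV0Pn[c /sub_kermxP cA] : kermx A != 0.
  by rewrite -mxrank_eq0 mxrank_ker subn_eq0 -ltnNge ltnS rank_leq_col.
case/negP; apply/eqP/rowP => i; rewrite mxE; apply: (uI (fun i => c 0 i)).
under eq_bigr do rewrite MP scaler_sumr.
rewrite exchange_big big1//= => j _; under eq_bigr do rewrite scalerA.
rewrite -scaler_suml; move/rowP/(_ j) : cA; rewrite !mxE.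
by under eq_bigr do rewrite mxE; move=> ->; rewrite scale0r.
Qed.

(** Independence of characters, by induction on their number: comparing the
    relation at [a + b] with [f n b] times the relation at [a] eliminates the
    last character and multiplies the other coefficients by [f i b - f n b]. *)
Lemma char_free (G : zmodType) (f : nat -> G -> R[i]) (c : nat -> R[i]) n :
    (forall i, dual_group (f i)) -> injective f ->
    (forall a, \sum_(i < n) c i * f i a = 0) ->
  forall i, (i < n)%N -> c i = 0.
Proof.
move=> fG fI; elim: n c => [//|n IH] c sum0.
have cn i : (i < n)%N -> c i = 0.
  move=> i_n; have [b fb] : exists b, f i b != f n b.
    apply: contrapT => /forallNP same; suff /fI i_eq : f i = f n.
      by rewrite i_eq ltnn in i_n.
    by apply/funext => b; apply/eqP; apply: contrapT; move/negP; exact: same.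
  have /(_ _ i i_n)/eqP := IH (fun i => c i * (f i b - f n b)).
  rewrite mulf_eq0 subr_eq0 (negPf fb) orbF => h; apply/eqP/h => a.
  have := sum0 (a + b); rewrite big_ord_recr/= => /eqP; rewrite addr_eq0 => /eqP sum_ab.
  have := sum0 a; rewrite big_ord_recr/= => /eqP; rewrite addr_eq0 => /eqP sum_a.
  transitivity (\sum_(i < n) c i * f i (a + b) - f n b * \sum_(i < n) c i * f i a).
    rewrite mulr_sumr -sumrB; apply: eq_bigr => j _.
    by rewrite charD//; ring.
  by rewrite sum_ab sum_a charD//; ring.
move=> i; rewrite ltnS leq_eqVlt => /orP[/eqP->|/cn//].
have := sum0 0; rewrite big_ord_recr/= big1 => [|j _]; last by rewrite cn// mul0r.
by rewrite add0r char0// mulr1.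
Qed.

End LinearIndependence.

(** * The translation representation *)

Lemma opnorm_le (R : realType) (X : completeNormedModType R[i]) (T : X -> X) (c : R) :
  0 <= c -> (forall x, rnorm (T x) <= c * rnorm x) -> (opnorm T <= c%:E)%E.
Proof.
move=> c0 Tc; apply: ge_ereal_sup => _ [x /= x1 <-]; rewrite lee_fin.
by apply: le_trans (Tc x) _; rewrite ler_piMr.
Qed.

Section Translation.
Context {R : realType} {G : zmodType}.
Variables (w : G -> R) (K : set (G -> R[i]^o)).
Hypotheses (w_ge1 : forall a, 1 <= w a) (K_char : K `<=` @dual_group R G).
Hypothesis w_submul : forall a b, w (a + b) <= w a * w b.

Let w_ge0 a : 0 <= w a. Proof. exact: le_trans (w_ge1 a). Qed.
Let w_gt0 a : 0 < w a. Proof. exact: lt_le_trans (w_ge1 a). Qed.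

Notation X := (span_space w_ge1 K_char).

Lemma lincombE (s : seq (R[i] * (G -> R[i]^o))) a :
  lincomb s a = \sum_(t <- s) t.1 * t.2 a.
Proof.
rewrite /lincomb; elim: s => [|t s IH]; first by rewrite !big_nil.
by rewrite !big_cons -IH.
Qed.

(** A translate of a character is a multiple of it, so translation preserves
    combinations of [K]; submultiplicativity of the weight controls the error. *)
Lemma translate_approx_span a (F : X) : (fun b => F (b + a)) \in approx_span w K.
Proof.
apply/approx_spanP => e e0; case: F => F /= /approx_spanP FK.
have [s sK Fs] := FK _ (divr_gt0 e0 (w_gt0 a)).
exists [seq (t.1 * t.2 a, t.2) | t <- s] => [_ /mapP[t ts ->]|b]; first exact: sK t ts.
rewrite [lincomb _ _](_ : _ = lincomb s (b + a)).
  apply: le_trans (Fs _) _; rewrite -mulrA ler_pM2l// mulrC ler_pdivrMr//.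
rewrite !lincombE big_map; apply: eq_big_seq => t /sK/K_char tG.
by rewrite charD//=; ring.
Qed.

Definition translate a (F : X) : X := SpanSpace w_ge1 K_char (translate_approx_span a F).

Lemma translate_rnorm a F : rnorm (translate a F) <= w a * rnorm F.
Proof.
apply: rnorm_span_le => b; apply: le_trans (rnorm_span_ub F (b + a)) _.
by rewrite [w a * _]mulrC -mulrA ler_wpM2l ?rnorm_ge0// [w a * _]mulrC.
Qed.

Lemma translate_opnorm a : (opnorm (translate a) <= (w a)%:E)%E.
Proof. by apply: opnorm_le => // x; exact: translate_rnorm. Qed.

Lemma translate_comp a b : translate (a + b) = translate a \o translate b.
Proof. by apply/funext => F; apply/val_inj/funext => c /=; rewrite addrA. Qed.

Lemma translateK a : cancel (translate a) (translate (- a)).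
Proof. by move=> F; apply/val_inj/funext => b /=; rewrite subrK. Qed.

Lemma translate_bounded_linear a : bounded_linear (translate a).
Proof.
split; last exact: le_lt_trans (translate_opnorm a) (ltry _).
by move=> c F H; apply/val_inj/funext.
Qed.

Lemma translate_GL a : GL (translate a).
Proof.
split; first exact: translate_bounded_linear.
exists (translate (- a)); split; first exact: translate_bounded_linear.
  exact: translateK.
by move=> F; rewrite -[X in translate X](opprK a) translateK.
Qed.

Lemma char_approx_span chi : K chi -> chi \in approx_span w K.
Proof.
move=> chiK; apply/approx_spanP => e e0; exists [:: (1, chi)] => [t|a].
  by rewrite inE => /eqP ->.
by rewrite lincombE big_seq1 mul1r subrr rnorm0 mulr_ge0// ltW.
Qed.

Definition char_vector chi (chiK : K chi) : X :=
  SpanSpace w_ge1 K_char (char_approx_span chiK).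

Lemma char_vector_eigen chi (chiK : K chi) a :
  translate a (char_vector chiK) = chi a *: char_vector chiK.
Proof.
have chiG := K_char chiK; apply/val_inj/funext => b.
by rewrite -[RHS]/(chi a * chi b) -(charD _ _ chiG) addrC.
Qed.

Lemma char_vector_neq0 chi (chiK : K chi) : char_vector chiK != 0.
Proof.
apply/eqP => /(congr1 (fun F : X => F 0)) /= /eqP.
by apply/negP; apply: char_neq0; exact: K_char.
Qed.

Lemma translate_eigenvalues : K `<=` unimodular_eigenvalues translate.
Proof.
move=> chi chiK; split; first exact: K_char.
by exists (char_vector chiK); [exact: char_vector_neq0 | exact: char_vector_eigen].
Qed.

(** [K] is infinite, and its characters are linearly independent. *)
Lemma span_space_infinite_dimensional : ~ countable K -> infinite_dimensional X.
Proof.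
move=> Kunc; apply: infinite_dimensional_of_free => n.
have Kinf : infinite_set K by apply: contra_not Kunc => /finite_set_countable.
have /infiniteP/ppcard_leP[f] := Kinf.
have fK i : K (f i) by apply: funS.
exists (fun i : 'I_n => char_vector (fK i)) => c sum0 i.
(* [char_free] takes coefficients indexed by all naturals: extend [c] by zero. *)
pose c' k := oapp c 0 (insub k : option 'I_n).
have c'E (j : 'I_n) : c' j = c j by rewrite /c' valK.
rewrite -c'E; apply: (@char_free R G f c' n) => //.
  by move=> j; exact/K_char.
move=> a; rewrite -[RHS]/((0 : X) a) -sum0.
transitivity (\sum_(j < n) (c j *: char_vector (fK j)) a).
  by apply: eq_bigr => j _; rewrite c'E.
by elim/big_ind2 : _ => // x1 _ y1 _ -> ->.
Qed.

(** The vectors of [X] that are characters in [D] generate a dense subspace, by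
    replacing each character of a combination of [K] with a close one in [D]. *)
Lemma span_space_separable (D : set (G -> R[i])) : countable D -> D `<=` K ->
    (forall chi, K chi -> forall e : R, 0 < e ->
       exists2 phi, D phi & forall a, modulus (chi a - phi a) <= e * w a) ->
  separable_space X.
Proof.
move=> Dc DK Dapprox.
pose E := [set F : X | D F].
apply: (@separable_of_generators _ _ E).
  apply: (@countable_of_selection _ _ E D (fun F phi => span_fun F = phi)) => //.
    by move=> F EF; exists F.
  by move=> F H phi _ _ FH HH; apply/val_inj; rewrite /= FH HH.
move=> F e e0.
have e2 : 0 < e / 2 by rewrite divr_gt0.
have e4 : 0 < e / 2 / 2 by rewrite divr_gt0.
case: (F) => F' F'K; have /approx_spanP/(_ _ e4)[s sK Fs] := F'K.
suff [q qE sq] : exists2 q : seq (R[i] * X), (forall t, t \in q -> E t.2) &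
    forall a, modulus (lincomb s a - (\sum_(t <- q) t.1 *: t.2) a) <= e / 2 / 2 * w a.
  exists q => //; apply: (@le_lt_trans _ _ (e / 2)); last first.
    by rewrite [ltRHS]splitr ltrDl.
  apply: rnorm_span_le => a; apply: le_trans (@rnorm_distD R R[i]^o (lincomb s a) _ _) _.
  by rewrite [e / 2 in leRHS]splitr mulrDl; apply: lerD.
elim: s sK {Fs} (e / 2 / 2) e4 => [|[c chi] s IH] sK d d0.
  exists [::] => // a.
  by rewrite lincombE !big_nil subrr rnorm0 mulr_ge0// ltW.
have d2 : 0 < d / 2 by rewrite divr_gt0.
have [|q qE sq] := IH _ _ d2.
  by move=> t ts; apply: sK; rewrite in_cons ts orbT.
have chiK : K chi by apply: (sK (c, chi)); rewrite mem_head.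
have c1 : 0 < modulus c + 1 by rewrite ltr_wpDl// rnorm_ge0.
have [phi Dphi chi_phi] := Dapprox _ chiK _ (divr_gt0 d2 c1).
exists ((c, char_vector (DK _ Dphi)) :: q) => [t|a].
  by rewrite in_cons => /orP[/eqP->//|/qE].
rewrite lincombE !big_cons/= -lincombE.
rewrite [X in modulus X](_ : _ = c * (chi a - phi a) +
    (lincomb s a - (\sum_(t <- q) t.1 *: t.2) a)); last first.
  by rewrite mulrBr opprD addrACA.
apply: le_trans (rnormD _ _) _; rewrite [d in leRHS]splitr mulrDl lerD// modulusM.
apply: le_trans (ler_wpM2l (rnorm_ge0 _) (chi_phi a)) _.
rewrite mulrA ler_wpM2r// mulrCA ger_pMr//.
by rewrite ler_pdivrMr// mul1r lerDl.
Qed.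

End Translation.

(** * Jamison sequences *)

Section Jamison.
Context {R : realType} {G : zmodType} {g : nat -> G}.
Hypothesis g_generates : generates g.

(** If [K] were separable, translations on the closed span of [K] with weight
    [2 ^ len] would be a partially bounded representation with all of [K] among
    its eigenvalues. *)
Lemma jamison_not_separable (K : set (G -> R[i])) :
  jamison_sequence R g -> K `<=` @dual_group R G -> ~ countable K ->
  ~ metric_separable (jdist g) K.
Proof.
move=> gJ KG Kunc [D [DK Dc Dd]]; apply: (Kunc).
pose len := word_length g_generates.
pose w a : R := 2 ^+ len a.
have w_ge1 a : 1 <= w a by rewrite exprn_ege1// ler1n.
have w_submul a b : w (a + b) <= w a * w b.
  by rewrite -exprD ler_weXn2l ?ler1n//; exact: word_lengthD.
have w_gen k : w (g k) <= 2.
  by rewrite -[leRHS]expr1 ler_weXn2l ?ler1n//; exact: word_length_gen.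
have len_le a : (len a)%:R <= w a by rewrite /w -natrX ler_nat ltnW// ltn_expl.
apply: sub_countable (gJ (span_space w_ge1 KG) (translate w_submul) _ _).
- exact/subset_card_le/translate_eigenvalues.
- split; [|exact: span_space_infinite_dimensional|exact: translate_GL|exact: translate_comp].
  apply: (@span_space_separable R G w K w_ge1 KG D Dc DK) => chi chiK e e0.
  have [phi Dphi phi_e] := Dd _ chiK e e0; exists phi => // a.
  have phiG : dual_group phi by exact/KG/DK.
  apply: le_trans (char_dist_word_length g_generates a (KG _ chiK) phiG) _.
  rewrite mulrC; apply: ler_pM => //; last exact: ltW.
  by apply: le_trans (jdist_ge 0 (KG _ chiK) phiG); exact: rnorm_ge0.
- apply: (@le_lt_trans _ _ 2%:E); last exact: ltry.
  apply: ge_ereal_sup => _ [k _ <-].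
  by apply: (le_trans (translate_opnorm w_ge1 KG w_submul (g k))); rewrite lee_fin.
Qed.

Lemma linear_scale (X : lmodType R[i]) (T : X -> X) : linear T ->
  forall a x, T (a *: x) = a *: T x.
Proof.
move=> Tlin a x; have T0 : T 0 = 0.
  have := Tlin 1 0 0; rewrite !scale1r addr0 => /eqP.
  by rewrite -subr_eq0 opprD addNKr oppr_eq0 => /eqP.
by have := Tlin a x 0; rewrite T0 !addr0.
Qed.

Lemma rnorm_le_opnorm (X : completeNormedModType R[i]) (T : X -> X) (c : R) x :
  linear T -> (opnorm T <= c%:E)%E -> rnorm (T x) <= c * rnorm x.
Proof.
move=> Tlin Tc.
have TZ := linear_scale Tlin.
have [->|x0] := eqVneq x 0.
  by rewrite -(scale0r (0 : X)) TZ !scale0r rnorm0 mulr0.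
have nx : 0 < rnorm x by rewrite rnorm_gt0.
rewrite -ler_pdivrMr// mulrC -lee_fin; apply: le_trans Tc.
have nV : modulus (rnorm x)^-1%:C = (rnorm x)^-1.
  by rewrite modulusR ger0_norm// invr_ge0 ltW.
apply: ereal_sup_ubound; exists ((rnorm x)^-1%:C *: x) => /=.
  by rewrite rnormZ nV mulVf// gt_eqF.
by rewrite TZ rnormZ nV.
Qed.

Lemma uniformly_separated_jamison (e : R) : 0 < e ->
  separated (jdist g) e (@dual_group R G) -> jamison_sequence R g.
Proof.
move=> e0 esep X rho [[D [Dc Dd]] _ rhoGL _] bounded.
have [M M0 rhoM] : exists2 M : R, 0 <= M &
    forall k x, rnorm (rho (g k) x) <= M * rnorm x.
  have [M supM] : exists M : R,
      (ereal_sup (range (fun k => opnorm (rho (g k)))) <= M%:E)%E.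
    move: bounded; rewrite /partially_bounded; case: ereal_sup => [r _|//|_].
      by exists r.
    by exists 0; exact: leNye.
  exists `|M| => // k x; apply: rnorm_le_opnorm.
    by have [[]] := rhoGL (g k).
  apply: le_trans (_ : _ <= M%:E)%E _; last by rewrite lee_fin ler_norm.
  by apply: le_trans supM; apply: ereal_sup_ubound; exists k.
have M1 : 0 < M + 1 by rewrite ltr_wpDl.
(* Apply [rho (g k)] to [u - v]: it differs from [chi (g k) *: (u - v)] by
   [(chi (g k) - phi (g k)) *: v], and [v] has norm one. *)
have eigen_dist chi phi (u v : X) : dual_group chi -> rnorm v = 1 ->
    (forall a, rho a u = chi a *: u) -> (forall a, rho a v = phi a *: v) ->
    jdist g chi phi <= (M + 1) * rnorm (u - v).
  move=> chiG v1 uE vE; apply: jdist_le => k.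
  have rhoB : rho (g k) (u - v) = rho (g k) u - rho (g k) v.
    have [[lin _] _] := rhoGL (g k).
    by rewrite addrC -scaleN1r lin scaleN1r addrC.
  rewrite -[leLHS]mulr1 -[X in _ * X <= _]v1 -rnormZ.
  have -> : (chi (g k) - phi (g k)) *: v = rho (g k) (u - v) - chi (g k) *: (u - v).
    by rewrite rhoB uE vE scalerBr scalerBl opprB [RHS]addrC subrKA.
  apply: le_trans (rnormD _ _) _; rewrite rnormN rnormZ modulus_char// mulrDl mul1r.
  by rewrite lerD2r rhoM.
(* Eigenvectors within [d] of the same point are at distance less than
   [e / (M + 1)], hence belong to the same character. *)
pose d := e / 2 / (M + 1).
have d0 : 0 < d by rewrite !divr_gt0.
apply: (countable_of_selection (D := D) (near := fun chi y => exists u : X,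
  [/\ rnorm u = 1, forall a, rho a u = chi a *: u & rnorm (u - y) < d])) => //.
  move=> chi [chiG [v v0 vE]].
  pose u := (rnorm v)^-1%:C *: v.
  have nv : 0 < rnorm v by rewrite rnorm_gt0.
  have u1 : rnorm u = 1.
    by rewrite rnormZ modulusR ger0_norm ?mulVf ?gt_eqF// invr_ge0 ltW.
  have uE a : rho a u = chi a *: u.
    have [[lin _] _] := rhoGL a.
    by rewrite (linear_scale lin) vE !scalerA mulrC.
  have [|y [uy Dy]] := Dd (ball u d%:C) _ (ball_open _ _).
    by exists u; apply: ballxx; rewrite ltcR.
  exists y => //; exists u; split => //.
  by move: uy; rewrite -ball_normE /= -rnorm_lt.
move=> chi phi y [chiG _] [phiG _] [u [u1 uE uy]] [v [v1 vE vy]].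
apply: contrapT => chi_phi.
have := esep _ _ chiG phiG chi_phi; apply/negP; rewrite -ltNge.
apply: le_lt_trans (eigen_dist _ _ _ _ chiG v1 uE vE) _.
rewrite mulrC -ltr_pdivlMr//; apply: le_lt_trans (rnorm_distD y _ _) _.
rewrite [e]splitr mulrDl; apply: ltrD => //; rewrite rnorm_distC//.
Qed.

End Jamison.

(** * Perfect sets of characters *)

Section PerfectSet.
Context {R : realType} {G : zmodType} {g : nat -> G}.
Hypothesis g_generates : generates g.

Let dG := @dual_group R G.

(** Completeness of the dual group for [jdist g].  The bound by word length makes
    the sequence Cauchy at every point of [G], not only at the [g k]; limits of
    characters are characters. *)
Lemma dual_group_complete (p : nat -> G -> R[i]) (r : nat -> R) :
    (forall n, dG (p n)) -> r @ \oo --> (0 : R) ->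
    (forall n m, (n <= m)%N -> jdist g (p n) (p m) <= r n) ->
  exists2 chi, dG chi & forall n, jdist g (p n) chi <= r n.
Proof.
move=> pG r0 pr.
have p_near a n m : (n <= m)%N ->
    modulus (p n a - p m a) <= (word_length g_generates a)%:R * r n.
  move=> nm; apply: le_trans (char_dist_word_length g_generates a (pG n) (pG m)) _.
  by rewrite ler_wpM2l// pr.
have p_cvg a : cvg ((fun n => p n a : R[i]^o) @ \oo).
  apply: complex_cauchy_cvg; apply: cauchy_exP => _ /gt0_complexP[e e0 ->].
  pose len : R := (word_length g_generates a)%:R.
  have : (fun n => len * r n) @ \oo --> (0 : R).
    by rewrite -[0](mulr0 len); apply: cvgM r0; exact: cvg_cst.
  move=> /cvgrPdist_lt/(_ e e0)[N _ /(_ N (leqnn N)) /=].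
  rewrite sub0r normrN => rN.
  exists (p N a); exists N => // m /= Nm.
  rewrite -ball_normE/= -rnorm_lt; apply: le_lt_trans (p_near _ _ _ Nm) _.
  exact: le_lt_trans (ler_norm _) rN.
have [chi chiP] := choice (fun a => (cvg_ex _).1 (p_cvg a)).
have lim_near a n c : (forall m, (n <= m)%N -> modulus (p n a - p m a) <= c) ->
    modulus (p n a - chi a) <= c.
  move=> pc; apply/ler_addgt0Pr => d d0.
  have /cvgrPdist_lt/(_ d%:C) := chiP a; rewrite ltcR => /(_ d0)[N _ Nd].
  have := Nd (maxn N n) (leq_maxl _ _); rewrite /= -rnorm_lt => close.
  apply: le_trans (@rnorm_distD R R[i]^o (p (maxn N n) a) _ _) _; apply: lerD.
    exact/pc/leq_maxr.
  by rewrite rnorm_distC ltW.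
exists chi; last first.
  move=> n; apply: jdist_le => k; apply: lim_near => m nm.
  by apply: le_trans (jdist_ge k (pG n) (pG m)) _; exact: pr.
split=> [a|a b].
  have norm1 : (fun=> 1 : R[i]^o) @ \oo --> (`|chi a| : R[i]^o).
    rewrite (_ : (fun=> 1) = fun n => `|p n a|); first exact: cvg_norm (chiP a).
    by apply/funext => n; rewrite (proj1 (pG n)).
  by apply: esym; exact: (@norm_cvg_unique _ R[i]^o _ _ _ _ (cvg_cst _) norm1).
apply: (@norm_cvg_unique _ R[i]^o _ _ _ _ (chiP (a + b))).
rewrite (_ : (fun n => p n (a + b)) = fun n => p n a * p n b).
  exact: (@cvgM _ _ _ _ (p^~ a) (p^~ b) _ _ (chiP a) (chiP b)).
by apply/funext => n; rewrite (charD _ _ (pG n)).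
Qed.

Definition jclosure (Gamma : set (G -> R[i])) : set (G -> R[i]) :=
  [set chi | dG chi /\ forall e : R, 0 < e -> exists2 p, Gamma p & jdist g chi p < e].

Let jd := jdist_distance R g_generates.

Let jdist_refl chi : dG chi -> jdist g chi chi = 0.
Proof. by have [_ d_eq0 _ _] := jd; move=> chiG; apply/d_eq0. Qed.

(** A complete space without isolated points is uncountable.  Given an
    enumeration [h], shrink balls with centres in [Gamma]: the [n]-th step moves
    to a nearby centre different from [h n], possible as no point of [Gamma] is
    isolated, and takes a radius below half the distance to [h n].  The common
    point of the balls is none of the [h n]. *)
Lemma jclosure_uncountable (Gamma : set (G -> R[i])) :
    Gamma `<=` dG -> Gamma !=set0 ->
    (forall p (e : R), Gamma p -> 0 < e ->
       exists q, [/\ Gamma q, q <> p & jdist g p q < e]) ->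
  ~ countable (jclosure Gamma).
Proof.
move=> GammaG [p0 Gp0] perfect /countable_injP[code codeI].
have [d_ge0 d_eq0 d_sym d_tri] := jd.
have decodeP n : exists chi, dG chi /\
    forall phi, jclosure Gamma phi -> code phi = n -> phi = chi.
  have [[y [Ey yn]]|noy] := pselect (exists y, jclosure Gamma y /\ code y = n).
    exists y; split=> [|z Ez zn]; first by have [] := Ey.
    by apply: codeI; rewrite ?inE// yn zn.
  by exists p0; split=> [|y Ey yn]; [exact: GammaG|case: noy; exists y].
have [h hP] := choice decodeP.
(* A state is a pair (centre, radius). *)
pose good (x : (G -> R[i]) * R) := Gamma x.1 /\ 0 < x.2.
have stepP (nx : nat * ((G -> R[i]) * R)) : exists y : (G -> R[i]) * R, good nx.2 ->
    [/\ good y, jdist g nx.2.1 y.1 <= nx.2.2 / 2, y.2 <= nx.2.2 / 2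
      & y.2 < jdist g y.1 (h nx.1)].
  case: nx => n [p r]; have [[Gp r0]|bad] := pselect (good (p, r)); last first.
    by exists (p, r) => /bad.
  have r2 : 0 < r / 2 by rewrite divr_gt0.
  have hG := proj1 (hP n).
  suff [q [Gq pq qh]] : exists q, [/\ Gamma q, jdist g p q <= r / 2 & q <> h n].
    have qh0 : 0 < jdist g q (h n).
      rewrite lt_neqAle d_ge0 ?andbT//; last exact: GammaG.
      rewrite eq_sym; apply/eqP => /(d_eq0 _ _ (GammaG _ Gq) hG).
      exact: qh.
    exists (q, Num.min (r / 2) (jdist g q (h n) / 2)) => _.
    split=> //=; first by split=> //=; rewrite lt_min r2 divr_gt0.
      by rewrite ge_min lexx.
    by rewrite gt_min; apply/orP; right; lra.
  have [ph|ph] := pselect (p = h n); last first.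
    by exists p; split=> //; rewrite jdist_refl ?ltW//; exact: GammaG.
  have [q [Gq qp pq]] := perfect p (r / 2) Gp r2.
  by exists q; split=> //; [exact: ltW | rewrite -ph].
have [step stepE] := choice stepP.
pose st := fix st n := if n is m.+1 then step (m, st m) else (p0, 1 : R).
have st_good n : good (st n).
  by elim: n => [|n IH]; [split | have [] := stepE (n, st n) IH].
have stS n := stepE (n, st n) (st_good n).
have pG n : dG (st n).1 by apply: GammaG; have [] := st_good n.
(* Halving both the steps and the radii keeps every later ball inside the [n]-th
   one, which bounds the distances between centres. *)
have st_dist n k : jdist g (st n).1 (st (n + k)%N).1 + (st (n + k)%N).2 <= (st n).2.
  elim: k => [|k IH].
    by rewrite addn0 jdist_refl// add0r.
  rewrite addnS; have [_ /= dk rk _] := stS (n + k)%N.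
  have := d_tri _ _ _ (pG n) (pG (n + k)%N) (pG (n + k).+1); move: dk rk IH => /=.
  lra.
have radius n : (st n).2 <= 2^-1 ^+ n.
  elim: n => [|n IH]; first by rewrite expr0.
  have [_ _ rn _] := stS n; rewrite exprS mulrC.
  by apply: le_trans rn _; rewrite ler_pM2r.
have radius0 : (fun n => (st n).2) @ \oo --> (0 : R).
  apply: (@squeeze_cvgr _ _ _ _ (cst 0) (fun n => 2^-1 ^+ n)).
  - by near=> n; rewrite radius ltW//; have [] := st_good n.
  - exact: cvg_cst.
  - by apply: cvg_expr; rewrite ger0_norm// invf_lt1// ltr1n.
have [chi chiG chi_near] : exists2 chi, dG chi &
    forall n, jdist g (st n).1 chi <= (st n).2.
  apply: dual_group_complete => // n m nm; rewrite -(subnKC nm).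
  apply: le_trans (st_dist n (m - n)%N); rewrite lerDl ltW//.
  by have [] := st_good (n + (m - n))%N.
have chi_cl : jclosure Gamma chi.
  split=> // e e0; have /cvgrPdist_lt/(_ e e0)[N _ /(_ N (leqnn N))] := radius0.
  rewrite /= sub0r normrN => rN.
  exists (st N).1; first by have [] := st_good N.
  rewrite (d_sym _ _ chiG (pG N)); apply: le_lt_trans (chi_near N) _.
  exact: le_lt_trans (ler_norm _) rN.
pose n := code chi.
have chi_h : chi = h n by apply: (proj2 (hP n)).
have [_ _ _] := stS n; rewrite /= -chi_h ltNge.
by have /= -> := chi_near n.+1.
Unshelve. all: by end_near. Qed.

Lemma jclosure_separable (Gamma : set (G -> R[i])) :
  Gamma `<=` dG -> countable Gamma -> metric_separable (jdist g) (jclosure Gamma).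
Proof.
move=> GammaG Gc; exists Gamma; split=> // [p Gp|chi [_ chi_near] e e0].
  split=> [|e e0]; first exact: GammaG.
  by exists p => //; rewrite jdist_refl//; exact: GammaG.
exact: chi_near.
Qed.

(** Quotients of close distinct characters give [psi n <> 1] at distance less than
    [1 / (n + 1)] from 1.  In the monoid of their products no point is isolated,
    since [P s] and [psi n * P s] are as close as [1] and [psi n]. *)
Lemma separable_uncountable_ex :
    (~ exists2 e : R, 0 < e & separated (jdist g) e dG) ->
  exists K : set (G -> R[i]),
    [/\ K `<=` dG, ~ countable K & metric_separable (jdist g) K].
Proof.
move=> notsep; have [d_ge0 d_eq0 d_sym _] := jd.
have smallP n : exists psi, [/\ dG psi, psi <> (fun=> 1) &
    jdist g psi (fun=> 1) < n.+1%:R^-1].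
  apply: contrapT => nopsi; apply: notsep; exists n.+1%:R^-1 => //.
  move=> chi phi chiG phiG chi_phi; rewrite leNgt; apply/negP => close.
  apply: nopsi; exists (fun a => chi a / phi a); split; first exact: char_div.
    move=> eq1; apply: chi_phi; apply/funext => a.
    by rewrite -[chi a](divfK (char_neq0 a phiG)) (congr1 (@^~ a) eq1) mul1r.
  rewrite -(jdist_mulr _ _ phiG); congr (jdist g _ _ < _) : close.
    by apply/funext => a; rewrite divfK// char_neq0.
  by apply/funext => a; rewrite mul1r.
have [psi psiP] := choice smallP.
pose P (s : seq nat) : G -> R[i] := fun a => \prod_(i <- s) psi i a.
have P_cons i s : P (i :: s) = fun a => psi i a * P s a.
  by apply/funext => a; rewrite /P big_cons.
have PG s : dG (P s).
  elim: s => [|i s IH]; last by rewrite P_cons; apply: char_mul => //; have [] := psiP i.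
  rewrite (_ : P [::] = fun=> 1); first exact: char_one.
  by apply/funext => a; rewrite /P big_nil.
have GammaG : range P `<=` dG by move=> _ [s _ <-].
exists (jclosure (range P)); split; first by move=> chi [].
  apply: jclosure_uncountable => //; first by exists (P [::]), [::].
  move=> _ e [s _ <-] e0.
  have [N Ne] : exists N, N.+1%:R^-1 < e.
    by exists (Num.truncn e^-1); rewrite invf_plt ?posrE// truncnS_gt.
  have [psiG psi1 psi_small] := psiP N.
  have Pfold : (fun a => 1 * P s a) = P s by apply/funext => a; rewrite mul1r.
  exists (P (N :: s)); split; first by exists (N :: s).
    rewrite P_cons -{2}Pfold => eqP1; apply: psi1; apply/funext => a.
    exact: (mulIf (char_neq0 a (PG s)) (congr1 (@^~ a) eqP1)).
  rewrite (d_sym _ _ (PG _) (PG _)) P_cons -{2}Pfold (jdist_mulr _ _ (PG s)).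
  exact: lt_trans Ne.
by apply: jclosure_separable => //; exact: countable_range.
Qed.

(** Balls of radius [e / 2] meet an [e]-separated set in at most one point. *)
Lemma separated_countable (K A : set (G -> R[i])) (e : R) : 0 < e ->
  K `<=` dG -> metric_separable (jdist g) K -> A `<=` K -> separated (jdist g) e A ->
  countable A.
Proof.
move=> e0 KG [D [DK Dc Dd]] AK Asep; have [_ _ d_sym d_tri] := jd.
have e2 : 0 < e / 2 by rewrite divr_gt0.
apply: (countable_of_selection (D := D)
  (near := fun x y => D y /\ jdist g x y < e / 2)) => //.
  by move=> x /AK Kx; have [y Dy xy] := Dd x Kx _ e2; exists y.
move=> x x' y Ax Ax' [Dy xy] [_ x'y]; apply: contrapT => xx'.
have := Asep _ _ Ax Ax' xx'; apply/negP; rewrite -ltNge.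
have [xG x'G yG] := And3 (KG _ (AK _ Ax)) (KG _ (AK _ Ax')) (KG _ (DK _ Dy)).
apply: le_lt_trans (d_tri _ y _ xG yG x'G) _.
by rewrite [e]splitr ltrD// d_sym.
Qed.

End PerfectSet.

(** * The equivalence *)

Theorem theorem4p2 (R : realType) (G : zmodType)
    (G_countable : countable [set: G]) (G_infinite : infinite_set [set: G])
    (g : nat -> G) (g_generates : generates g) :
  [<-> jamison_sequence R g;
       forall K : set (G -> R[i]), K `<=` @dual_group R G -> ~ countable K ->
         ~ metric_separable (jdist g) K;
       forall K : set (G -> R[i]), K `<=` @dual_group R G -> ~ countable K ->
         exists2 e : R, 0 < e &
           exists A : set (G -> R[i]),
             [/\ A `<=` K, ~ countable A & separated (jdist g) e A];
       exists2 e : R, 0 < e &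
         forall K : set (G -> R[i]), K `<=` @dual_group R G -> ~ countable K ->
           exists A : set (G -> R[i]),
             [/\ A `<=` K, ~ countable A & separated (jdist g) e A];
       exists2 e : R, 0 < e &
         forall chi phi : G -> R[i], dual_group chi -> dual_group phi -> chi <> phi ->
           e <= jdist g chi phi ].
Proof.
have sep_self (e : R) : separated (jdist g) e (@dual_group R G) ->
    forall K : set (G -> R[i]), K `<=` @dual_group R G -> ~ countable K ->
    exists A : set (G -> R[i]), [/\ A `<=` K, ~ countable A & separated (jdist g) e A].
  by move=> sep K KG Kunc; exists K; split=> // x y /KG xG /KG yG; exact: sep.
have unif_sep : (forall K : set (G -> R[i]), K `<=` @dual_group R G -> ~ countable K ->
      ~ metric_separable (jdist g) K) ->
    exists2 e : R, 0 < e & separated (jdist g) e (@dual_group R G).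
  move=> nsep; apply: contrapT => /(separable_uncountable_ex g_generates)[K [KG Kunc]].
  exact: nsep.
have not_separable (K A : set (G -> R[i])) (e : R) : 0 < e -> K `<=` @dual_group R G ->
    [/\ A `<=` K, ~ countable A & separated (jdist g) e A] ->
    ~ metric_separable (jdist g) K.
  move=> e0 KG [AK Aunc Asep] Ksep; apply: Aunc.
  exact: (separated_countable g_generates e0 KG Ksep AK Asep).
tfae.
- by move=> gJ K; exact: jamison_not_separable.
- by move=> /unif_sep[e e0 /sep_self sep] K KG Kunc; exists e => //; exact: sep.
- move=> sepK; have [K KG Kunc|e e0 /sep_self sep] := unif_sep; last by exists e.
  by have [e e0 [A]] := sepK K KG Kunc; exact: not_separable.
- move=> [e e0 sepK]; apply: unif_sep => K KG Kunc.
  by have [A] := sepK K KG Kunc; exact: not_separable.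
- by move=> [e e0 sep]; exact: uniformly_separated_jamison e0 sep.
Qed.
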